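(* Let $K$ be a field of characteristic zero, let $n\geq 2$ and $d\geq 2$, let $P=P\langle x_1,x_2,\ldots,x_n\rangle$ be the free Poisson algebra over $K$ in the variables $x_1,\ldots,x_n$, and let $P_0$ be its Veronese subalgebra of degree $d$. Then every Poisson derivation of $P_0$ can be uniquely extended to a $d$-graded Poisson derivation of $P$.
   Context: A Poisson algebra over $K$ is a $K$-vector space with two bilinear operations $x\cdot y$ and $\{x,y\}$ such that it is a commutative associative (unital) algebra under $\cdot$, a Lie algebra under $\{\,,\}$, and the Leibniz identity $\{x,y\cdot z\}=y\cdot\{x,z\}+\{x,y\}\cdot z$ holds. A Poisson derivation of a Poisson algebra $R$ is a $K$-linear map $D:R\to R$ with $D(xy)=D(x)y+xD(y)$ and $D(\{x,y\})=\{D(x),y\}+\{x,D(y)\}$ for all $x,y\in R$. The free Poisson algebra $P=P\langle x_1,\ldots,x_n\rangle$ is constructed as follows: let $L$ be the free Lie algebra over $K$ on $x_1,\ldots,x_n$, with a multihomogeneous linear basis $e_1,e_2,\ldots$; then $P$ is the polynomial algebra $K[e_1,e_2,\ldots]$ with the unique Poisson bracket satisfying the Leibniz identity and $\{e_i,e_j\}=[e_i,e_j]$ (bracket of $L$). The degree function on $P$ is determined by $\deg x_i=1$: $\deg e_i$ is the degree of $e_i$ in the free Lie algebra, and $\deg(e_{i_1}\cdots e_{i_s})=\deg e_{i_1}+\cdots+\deg e_{i_s}$. For $0\le i\le d-1$ let $P_i$ be the linear span of all homogeneous elements of $P$ of degree $kd+i$, $k\geq 0$. Then $P=P_0\oplus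 P_1\oplus\cdots\oplus P_{d-1}$ with $P_iP_j\subseteq P_{i+j}$ and $\{P_i,P_j\}\subseteq P_{i+j}$ (indices in $\mathbb{Z}/d\mathbb{Z}$). The Poisson subalgebra $P_0$ is the Veronese subalgebra of $P$ of degree $d$. A Poisson derivation $D$ of $P$ is called $d$-graded if $D(x_1),\ldots,D(x_n)\in P_1$. *)

(* Defs.v *)
From mathcomp Require Import all_boot all_order all_algebra finmap.
From mathcomp.multinomials Require Export monalg.

Set Implicit Arguments.
Unset Strict Implicit.
Unset Printing Implicit Defensive.

Import GRing.Theory.
Local Open Scope ring_scope.

Section Linear.
Variables (K : fieldType) (V : lmodType K).

Definition linear_span (S : V -> Prop) (v : V) : Prop :=
  exists (m : nat) (c : 'I_m -> K) (w : 'I_m -> V),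
    (forall i, S (w i)) /\ v = \sum_(i < m) c i *: w i.

Definition linear_basis (e : nat -> V) : Prop :=
  (forall v, exists (m : nat) (c : 'I_m -> K), v = \sum_(i < m) c i *: e i) /\
  (forall (m : nat) (c : 'I_m -> K),
     \sum_(i < m) c i *: e i = 0 -> forall i, c i = 0).

Definition lie_bracket (br : V -> V -> V) : Prop :=
  [/\ forall (a : K) u v w, br (a *: u + v) w = a *: br u w + br v w,
      forall (a : K) u v w, br u (a *: v + w) = a *: br u v + br u w,
      forall u, br u u = 0
    & forall u v w, br u (br v w) + br v (br w u) + br w (br u v) = 0].

End Linear.

Definition poisson_bracket (K : fieldType) (A : comAlgType K)
    (br : A -> A -> A) : Prop :=
  lie_bracket br /\
  forall f g h : A, br f (g * h) = g * br f h + br f g * h.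

(* Poisson derivations of the subalgebra with carrier R of the Poisson algebra
   A: only the restriction of D to R is constrained, so this describes the maps
   R -> R, and R := fun=> True gives the Poisson derivations of A itself. *)
Definition poisson_derivation_on (K : fieldType) (A : comAlgType K)
    (br : A -> A -> A) (R : A -> Prop) (D : A -> A) : Prop :=
  [/\ forall f, R f -> R (D f),
      forall (a : K) f g, R f -> R g -> D (a *: f + g) = a *: D f + D g,
      forall f g, R f -> R g -> D (f * g) = D f * g + f * D g
    & forall f g, R f -> R g -> D (br f g) = br (D f) g + br f (D g)].

Definition poisson_derivation (K : fieldType) (A : comAlgType K)
    (br : A -> A -> A) : (A -> A) -> Prop :=
  poisson_derivation_on br (fun=> True).

Definition lie_morphism (K : fieldType) (L M : lmodType K)
    (brL : L -> L -> L) (brM : M -> M -> M) (f : {linear L -> M}) : Prop :=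
  forall u v, f (brL u v) = brM (f u) (f v).

Definition free_lie_algebra (K : fieldType) (n : nat) (L : lmodType K)
    (br : L -> L -> L) (x : 'I_n -> L) : Prop :=
  lie_bracket br /\
  forall (M : lmodType K) (brM : M -> M -> M) (y : 'I_n -> M),
    lie_bracket brM ->
    (exists f : {linear L -> M},
       lie_morphism br brM f /\ forall i, f (x i) = y i) /\
    (forall f g : {linear L -> M},
       lie_morphism br brM f -> lie_morphism br brM g ->
       (forall i, f (x i) = y i) -> (forall i, g (x i) = y i) -> f =1 g).

Inductive lie_word (n : nat) : Type :=
| LVar of 'I_n
| LBr of lie_word n & lie_word n.

Fixpoint lie_eval (n : nat) (L : Type) (br : L -> L -> L) (x : 'I_n -> L)
    (w : lie_word n) : L :=
  match w with
  | LVar i => x i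
  | LBr u v => br (lie_eval br x u) (lie_eval br x v)
  end.

Fixpoint lie_mdeg (n : nat) (w : lie_word n) (i : 'I_n) : nat :=
  match w with
  | LVar j => (j == i) : nat
  | LBr u v => (lie_mdeg u i + lie_mdeg v i)%N
  end.

Definition multihomogeneous (K : fieldType) (n : nat) (L : lmodType K)
    (br : L -> L -> L) (x : 'I_n -> L) (a : 'I_n -> nat) : L -> Prop :=
  linear_span (fun u : L => exists w : lie_word n,
    lie_mdeg w =1 a /\ u = lie_eval br x w).

(* In a free Lie algebra the multihomogeneous components are independent, so
   the multidegrees mu j are determined by the (nonzero) vectors e j. *)
Definition multihomogeneous_basis (K : fieldType) (n : nat) (L : lmodType K)
    (br : L -> L -> L) (x : 'I_n -> L) (e : nat -> L)
    (mu : nat -> 'I_n -> nat) : Prop :=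
  linear_basis e /\ forall j, multihomogeneous br x (mu j) (e j).

(* K[e_0, e_1, ...], with e_j as its j-th variable. *)
Notation poly_alg K := {malg K[{cmonom nat}]}.

Definition poly_var (K : fieldType) (j : nat) : poly_alg K := << ucm j >>.

Section Degree.
Variables (K : fieldType) (n : nat) (mu : nat -> 'I_n -> nat).

Definition basis_deg (j : nat) : nat := (\sum_(i < n) mu j i)%N.

Definition monom_deg (m : {cmonom nat}) : nat :=
  (\sum_(j <- finsupp m) m j * basis_deg j)%N.

Definition homogeneous (k : nat) (f : poly_alg K) : Prop :=
  forall m, m \in msupp f -> monom_deg m = k.

Definition veronese_part (d i : nat) : poly_alg K -> Prop :=
  linear_span (fun f => exists k : nat, homogeneous (k * d + i) f).

End Degree.

(* The free Poisson algebra on x_0, ..., x_(n-1), as the polynomial algebra on a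
   multihomogeneous basis e of the free Lie algebra L, where iota : L -> K[e] is
   the linear embedding sending each basis vector to its variable. *)
Definition free_poisson_algebra (K : fieldType) (n : nat) (L : lmodType K)
    (brL : L -> L -> L) (x : 'I_n -> L) (e : nat -> L)
    (mu : nat -> 'I_n -> nat) (iota : {linear L -> poly_alg K})
    (brP : poly_alg K -> poly_alg K -> poly_alg K) : Prop :=
  [/\ free_lie_algebra brL x,
      multihomogeneous_basis brL x e mu,
      forall j, iota (e j) = poly_var K j,
      poisson_bracket brP
    & forall i j, brP (poly_var K i) (poly_var K j) = iota (brL (e i) (e j))].

Definition graded_poisson_derivation (K : fieldType) (n : nat) (L : lmodType K)
    (x : 'I_n -> L) (mu : nat -> 'I_n -> nat) (iota : {linear L -> poly_alg K})
    (brP : poly_alg K -> poly_alg K -> poly_alg K) (d : nat)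
    (D : poly_alg K -> poly_alg K) : Prop :=
  poisson_derivation brP D /\
  forall i : 'I_n, veronese_part mu d 1 (D (iota (x i))).

(* Main.v *)
Require Import Defs.
From mathcomp Require Import all_boot all_order all_algebra finmap.
From mathcomp Require Import ring.

Set Implicit Arguments.
Unset Strict Implicit.
Unset Printing Implicit Defensive.

Import GRing.Theory.
Local Open Scope ring_scope.

(* Over a field of characteristic zero a derivation [D] is determined by its
   values on the powers [e_j^d], which lie in [P_0], because [d e_j^(d-1)
   D(e_j) = D(e_j^d)]. Given [D] on [P_0], choose a variable [e_k] of degree
   1 other than [e_j] and [p] with [e_k^p e_j] in [P_0]: applying [D] to
   [(e_k^p e_j)^d] shows that [e_j^(d-1)] divides [e_k^(pd) D(e_j^d)], hence
   [D(e_j^d)]. The quotients define a derivation [E] of the polynomial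
   algebra [P] that agrees with [D] on [P_0]. Its defect [E{u,v} - {E u,v} -
   {u,E v}] is a biderivation vanishing on the pairs [(e_i^d, e_j^d)], so it
   is zero. *)

(** * Monomials, and divisibility by powers of a variable *)

Section Monomials.
Variable I : choiceType.
Implicit Types (m : {cmonom I}) (i j : I).

(** Induction on total degree: a monomial other than 1 has a variable in its support, which can be
    divided out. *)
Lemma cmonom_ind (Q : {cmonom I} -> Prop) :
  Q mone -> (forall i m, Q m -> Q (mmul (ucm i) m)) -> forall m, Q m.
Proof.
move=> Q1 QM m; have [k] := ubnP (mdeg m).
elim: k m => // k IHk m.
have [->//|m1 lt_mk] := eqVneq m mone.
have [i im] : exists i, i \in finsupp m.
  case: (fset_0Vmem (finsupp m)) => [m0|[i]]; last by exists i.
  by move: m1; rewrite -mdeg_eq0 mdegE m0 big_seq_fset0.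
have mi : (0 < m i)%N by rewrite lt0n cmE_neq0.
have Em : m = mmul (ucm i) (divcm m (ucm i)).
  apply/eqP/cmP => j; rewrite cmM divcmE cmU subnKC //.
  by case: eqP => // <-.
rewrite Em; apply/QM/IHk; move: lt_mk.
by rewrite {1}Em mdegM mdegU add1n ltnS.
Qed.

Lemma cmonom_mulI m : injective (mmul m).
Proof.
move=> m1 m2 /eqP/cmP E; apply/eqP/cmP => i.
by have := E i; rewrite !cmM => /addnI.
Qed.

Definition cmonom_pow m p := iter p (mmul m) mone.

Lemma cmonom_powE m p i : cmonom_pow m p i = (p * m i)%N.
Proof. by elim: p => [|p IH] /=; rewrite ?cm1 ?cmM ?IH ?mulSn. Qed.

Variable K : fieldType.
Implicit Types (f g : {malg K[{cmonom I}]}).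

Lemma monomialM m1 m2 :
  << mmul m1 m2 >> = << m1 >> * << m2 >> :> {malg K[{cmonom I}]}.
Proof. by rewrite malgM_def fgmulUU mulr1. Qed.

Lemma monomialX m p :
  << m >> ^+ p = << cmonom_pow m p >> :> {malg K[{cmonom I}]}.
Proof.
elim: p => [|p IH]; first by rewrite expr0 -mpolyC1E.
rewrite exprS IH -monomialM; reflexivity.
Qed.

Lemma mcoeff_monomialM m f k : (<< m >> * f)@_(mmul m k) = f@_k.
Proof.
rewrite malgM_def fgmulUg (raddf_sum (mcoeff _)) [in RHS](monalgE f).
rewrite (raddf_sum (mcoeff k)); apply: eq_bigr => m1 _.
by rewrite /= mul1r !mcoeffU (inj_eq (@cmonom_mulI m)).
Qed.

Lemma monomial_mulI m : injective (fun f => << m >> * f).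
Proof.
move=> f g /= E; apply/malgP => k.
rewrite -(mcoeff_monomialM m) E; exact: mcoeff_monomialM.
Qed.

Lemma monomialZ a m : << a *g m >> = a *: << m >> :> {malg K[{cmonom I}]}.
Proof.
rewrite -mul_malgC malgM_def fgmulUU. rewrite mulr1. rewrite mul1m. reflexivity.
Qed.

Lemma malg_ind (Q : {malg K[{cmonom I}]} -> Prop) :
  Q 0 -> (forall a m f, Q f -> Q (a *: << m >> + f)) -> forall f, Q f.
Proof.
move=> Q0 QD f; rewrite (monalgE f).
elim: (X in \sum_(k <- X) _) => [|m s IH]; first by rewrite big_nil.
rewrite big_cons monomialZ; exact: QD.
Qed.

(** Divisibility by a power of a variable can be tested on the support; the quotient is obtained by
    dividing each monomial separately. *)
Lemma dvd_varX i p f :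
  (exists g, f = << ucm i >> ^+ p * g) <->
  (forall m, m \in msupp f -> (p <= m i)%N).
Proof.
rewrite monomialX; split=> [[g ->] m /msuppM_le[m1 [m2 []]]|H].
  rewrite msuppU1.
  move/fset1P=> ->.
  move=> _ ->.
  by rewrite cmM cmonom_powE cmU eqxx muln1 leq_addr.
exists (\sum_(m <- msupp f) << f@_m *g divcm m (cmonom_pow (ucm i) p) >>).
rewrite {1}(monalgE f) mulr_sumr; apply: eq_big_seq => m /H le_p.
rewrite malgM_def fgmulUU mul1r.
suff /eqP <- : m == mmul (cmonom_pow (ucm i) p)
  (divcm m (cmonom_pow (ucm i) p)) by reflexivity.
apply/cmP => j; rewrite cmM divcmE cmonom_powE cmU subnKC //.
by case: eqP => [<-|_]; rewrite ?muln1 ?muln0.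
Qed.

(** Multiplying by a power of another variable translates the support without changing the exponents
    at [i], so the support criterion passes to [f]. *)
Lemma dvd_varX_coprime i k p q f g : i != k ->
  << ucm k >> ^+ q * f = << ucm i >> ^+ p * g ->
  exists h, f = << ucm i >> ^+ p * h.
Proof.
move=> ik E; apply/dvd_varX => m mf.
have /dvd_varX/(_ (mmul (cmonom_pow (ucm k) q) m)) :
  exists g, << ucm k >> ^+ q * f = << ucm i >> ^+ p * g by exists g.
rewrite cmM cmonom_powE cmU eq_sym (negPf ik) muln0; apply.
by rewrite -mcoeff_neq0 monomialX mcoeff_monomialM mcoeff_neq0.
Qed.

End Monomials.

(** * Derivations defined on a subalgebra *)

Section Derivations.
Variables (K : fieldType) (A : comAlgType K).
Implicit Types (R : A -> Prop) (D : A -> A).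

Definition subalgebra R : Prop :=
  [/\ R 1, forall (a : K) f g, R f -> R g -> R (a *: f + g)
    & forall f g, R f -> R g -> R (f * g)].

(** The values may lie outside [R], so that restrictions of derivations of the whole algebra can be
    compared with a map given on [R] alone. *)
Definition derivation_on R D : Prop :=
  (forall (a : K) f g, R f -> R g -> D (a *: f + g) = a *: D f + D g) /\
  (forall f g, R f -> R g -> D (f * g) = D f * g + f * D g).

Lemma subalgebra_full : subalgebra (fun=> True).
Proof. by []. Qed.

Variables (R : A -> Prop) (subR : subalgebra R).

Lemma subalgebra0 : R 0.
Proof.
case: subR => R1 RD _; suff -> : 0 = (-1) *: 1 + 1 :> A by apply: RD.
by rewrite scaleN1r addNr.
Qed.

Lemma subalgebraX f p : R f -> R (f ^+ p).
Proof.
case: subR => R1 _ RM Rf.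
by elim: p => // p IH; rewrite exprS; apply: RM.
Qed.

Lemma subalgebra_sum (T : eqType) (s : seq T) (c : T -> K) (w : T -> A) :
  (forall i, i \in s -> R (w i)) -> R (\sum_(i <- s) c i *: w i).
Proof.
case: subR => _ RD _; elim: s => [|i s IH] Rw.
  by rewrite big_nil; apply: subalgebra0.
rewrite big_cons; apply: RD; first by apply: Rw; rewrite inE eqxx.
by apply: IH => j js; apply: Rw; rewrite inE js orbT.
Qed.

Variables (D : A -> A) (derD : derivation_on R D).

Lemma derivation_on0 : D 0 = 0.
Proof.
case: derD => linD _; have R0 := subalgebra0.
by have := linD (-1) 0 0 R0 R0; rewrite !scaleN1r addr0 oppr0 addNr.
Qed.

Lemma derivation_on_sum (T : eqType) (s : seq T) (c : T -> K) (w : T -> A) :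
  (forall i, i \in s -> R (w i)) ->
  D (\sum_(i <- s) c i *: w i) = \sum_(i <- s) c i *: D (w i).
Proof.
case: derD => linD _; elim: s => [|i s IH] Rw.
  by rewrite !big_nil derivation_on0.
have Rs j : j \in s -> R (w j) by move=> js; apply: Rw; rewrite inE js orbT.
rewrite !big_cons linD ?IH //; first by apply: Rw; rewrite inE eqxx.
exact: subalgebra_sum.
Qed.

Lemma derivation_onD f g : R f -> R g -> D (f + g) = D f + D g.
Proof. by case: derD => linD _ Rf Rg; rewrite -[f]scale1r linD ?scale1r. Qed.

Lemma derivation_on1 : D 1 = 0.
Proof.
case: derD => _ leibD; have [R1 _ _] := subR.
by apply: (addIr (D 1)); rewrite add0r -{3}(mulr1 1) leibD // mulr1 mul1r.
Qed.

Lemma derivation_on_eqM D' f g : derivation_on R D' -> R f -> R g ->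
  D f = D' f -> D g = D' g -> D (f * g) = D' (f * g).
Proof.
case: derD => _ leibD [_ leibD'] Rf Rg Ef Eg.
by rewrite leibD // leibD' // Ef Eg.
Qed.

Lemma derivation_onX f p : R f -> D (f ^+ p) = f ^+ p.-1 * D f *+ p.
Proof.
move=> Rf; elim: p => [|p IH]; first by rewrite derivation_on1 mulr0n.
case: derD => _ leibD; rewrite exprS leibD ?IH //; last exact: subalgebraX.
rewrite mulrnAr mulrA -exprS mulrSr addrC [D f * _]mulrC.
(* [p.-1.+1] is [p] only for positive [p]; at 0 the term has multiplicity 0. *)
by case: p {IH} => [|p]; rewrite ?mulr0n.
Qed.

End Derivations.

(** * Derivations determined by powers of the variables *)

Section MonomialSubalgebra.
Variables (K : fieldType) (I : choiceType).
Hypothesis K_char0 : [pchar K] =i pred0.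
Local Notation P := {malg K[{cmonom I}]}.
Implicit Types (f g : P) (m : {cmonom I}).

(** A monomial is not a zero divisor, and [p.+1] is invertible in characteristic zero. *)
Lemma monomialX_mulIn m q p f g :
  << m >> ^+ q * f *+ p.+1 = << m >> ^+ q * g *+ p.+1 -> f = g.
Proof.
have nz : p.+1%:R != 0 :> K by rewrite ((pcharf0P K).1 K_char0).
rewrite -[LHS]scaler_nat -[RHS]scaler_nat => /(scalerI nz).
rewrite monomialX; exact: monomial_mulI.
Qed.

(* [d m^(d-1) D(m) = D(m^d)] makes a derivation on monomials a consequence of
   its values on the d-th powers of the variables. *)
Lemma derivation_on_eq (R : P -> Prop) (d : nat) (D D' : P -> P) :
  (0 < d)%N -> subalgebra R ->
  (forall f m, R f -> m \in msupp f -> R << m >>) ->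
  (forall m, R (<< m >> ^+ d)) ->
  derivation_on R D -> derivation_on R D' ->
  (forall i, D (<< ucm i >> ^+ d) = D' (<< ucm i >> ^+ d)) ->
  forall f, R f -> D f = D' f.
Proof.
case: d => // d _ subR Rmon Rpow derD derD' eqX f Rf.
have eqXm m : D (<< m >> ^+ d.+1) = D' (<< m >> ^+ d.+1).
  elim/cmonom_ind: m => [|i m IH].
    rewrite -[<< mone >>]/(1%:MP) mpolyC1E expr1n.
    by rewrite (derivation_on1 subR derD) (derivation_on1 subR derD').
  rewrite monomialM exprMn.
  exact: (derivation_on_eqM derD derD' (Rpow (ucm i)) (Rpow m) (eqX i) IH).
have eqm m : R << m >> -> D << m >> = D' << m >>.
  move=> Rm; have := eqXm m.
  rewrite (derivation_onX subR derD _ Rm) (derivation_onX subR derD' _ Rm).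
  exact: monomialX_mulIn.
have -> : f = \sum_(m <- msupp f) f@_m *: << m >>.
  rewrite {1}(monalgE f); apply: eq_bigr => m _.
  exact: monomialZ.
have Rs m : m \in enum_fset (msupp f) -> R << m >> by apply: Rmon.
rewrite (derivation_on_sum subR derD _ Rs) (derivation_on_sum subR derD' _ Rs).
apply: eq_big_seq => m /Rs /eqm ->; reflexivity.
Qed.

End MonomialSubalgebra.

(** * Auxiliary identities for the Leibniz rule *)

Section Leibniz.
Variables (K : fieldType) (A : comAlgType K).
Implicit Types f g t u v w : A.

(** One summand of the Leibniz rule for a product of two monomials, [p] and [q] being the exponents
    of a variable in the factors. Dividing by that variable is exact only at a positive exponent; at
    exponent 0 the summand vanishes. *)
Lemma scale_leibniz p q t u v w u' v' :
  (p != 0%N -> u = u' * v) -> (q != 0%N -> u = w * v') ->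
  (p + q)%:R *: (u * t) = p%:R *: (u' * t) * v + w * (q%:R *: (v' * t)).
Proof.
move=> Ep Eq; rewrite natrD scalerDl -scalerAl -scalerAr; congr (_ + _).
  by case: p Ep => [|p] E; rewrite ?scale0r // E // mulrAC.
by case: q Eq => [|q] E; rewrite ?scale0r // E // mulrA.
Qed.

Lemma mulrn_divn p f g :
  p%:R != 0 :> K -> f * (p%:R^-1 *: g) *+ p = f * g.
Proof.
by move=> nz; rewrite -scalerAr -[LHS]scaler_nat scalerA mulfV ?scale1r.
Qed.

Variable D : A -> A.
Hypothesis linD : forall (a : K) f g, D (a *: f + g) = a *: D f + D g.

Lemma leibnizDl a f1 f2 g :
  D (f1 * g) = D f1 * g + f1 * D g -> D (f2 * g) = D f2 * g + f2 * D g ->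
  D ((a *: f1 + f2) * g) = D (a *: f1 + f2) * g + (a *: f1 + f2) * D g.
Proof.
move=> E1 E2; rewrite mulrDl -scalerAl !linD E1 E2 scalerDr !mulrDl -!scalerAl.
exact: addrACA.
Qed.

Lemma leibnizDr a f1 f2 g :
  D (g * f1) = D g * f1 + g * D f1 -> D (g * f2) = D g * f2 + g * D f2 ->
  D (g * (a *: f1 + f2)) = D g * (a *: f1 + f2) + g * D (a *: f1 + f2).
Proof.
move=> E1 E2; rewrite mulrDr -scalerAr !linD E1 E2 scalerDr !mulrDr -!scalerAr.
exact: addrACA.
Qed.

End Leibniz.

(** * The derivation with prescribed values on the variables *)

Section DerivationOfVariables.
Variables (K : fieldType) (I : choiceType).
Local Notation P := {malg K[{cmonom I}]}.
Variable T : I -> P.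
Implicit Types (f g : P) (m : {cmonom I}).

(** The chain rule: the sum over [j] of the partial derivative of [m] in the variable [j], times
    [T j]. *)
Definition monomial_der m : P :=
  \sum_(j <- finsupp m) (m j)%:R *: (<< divcm m (ucm j) >> * T j).

Definition malg_der f : P := \sum_(m <- msupp f) f@_m *: monomial_der m.

(** Lets the sums for several monomials be taken over one common index set. *)
Lemma monomial_derEw (s : {fset I}) m : (finsupp m `<=` s)%fset ->
  monomial_der m =
    \sum_(j <- s) (m j)%:R *: (<< divcm m (ucm j) >> * T j).
Proof.
move=> le_s; apply: big_fset_incl => // j _.
by rewrite -cmE_eq0 => /eqP->; rewrite scale0r.
Qed.

Lemma malg_derEw (s : {fset {cmonom I}}) f : (msupp f `<=` s)%fset ->
  malg_der f = \sum_(m <- s) f@_m *: monomial_der m.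
Proof.
move=> le_s; apply: big_fset_incl => // m _.
by rewrite -mcoeff_eq0 => /eqP->; rewrite scale0r.
Qed.

Lemma malg_der_linear a f g :
  malg_der (a *: f + g) = a *: malg_der f + malg_der g.
Proof.
pose s := (msupp (a *: f + g) `|` (msupp f `|` msupp g))%fset.
rewrite (@malg_derEw s); last exact: fsubsetUl.
rewrite (@malg_derEw s f); last by rewrite fsubsetU // fsubsetUl orbT.
rewrite (@malg_derEw s g); last by rewrite fsubsetU // fsubsetUr orbT.
rewrite scaler_sumr -big_split; apply: eq_bigr => m _.
rewrite mcoeffD mcoeffZ scalerDl -scalerA; reflexivity.
Qed.

Lemma malg_der_monomial m : malg_der << m >> = monomial_der m.
Proof.
rewrite (@malg_derEw [fset m]%fset) ?msuppU1 // big_seq_fset1.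
by rewrite mcoeffUU scale1r.
Qed.

Lemma malg_der_var i : malg_der << ucm i >> = T i.
Proof.
rewrite malg_der_monomial /monomial_der mdomU big_seq_fset1 cmUU scale1r.
suff /eqP -> : divcm (ucm i) (ucm i) == mone.
  by rewrite -[<< mone >>]/(1%:MP) mpolyC1E mul1r.
by apply/cmP => j; rewrite divcmE subnn cm1.
Qed.

Lemma divcmMl m1 m2 j : m1 j != 0%N ->
  divcm (mmul m1 m2) (ucm j) = mmul (divcm m1 (ucm j)) m2.
Proof.
move=> nz; apply/eqP/cmP => i; rewrite divcmE !cmM divcmE cmU.
by rewrite addnBAC //; case: eqP => // <-; rewrite lt0n.
Qed.

Lemma monomial_derM m1 m2 :
  monomial_der (mmul m1 m2) =
    monomial_der m1 * << m2 >> + << m1 >> * monomial_der m2.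
Proof.
rewrite (@monomial_derEw _ m1 (fsubsetUl _ (finsupp m2))).
rewrite (@monomial_derEw _ m2 (fsubsetUr (finsupp m1) _)).
rewrite /monomial_der mdomD mulr_suml [X in _ = _ + X]mulr_sumr.
rewrite -big_split /=; apply: eq_bigr => j _; rewrite cmM.
apply: scale_leibniz => nz; first by rewrite (divcmMl _ nz) monomialM.
by rewrite mulmC (divcmMl _ nz) mulmC monomialM.
Qed.

Lemma malg_derP : derivation_on (fun=> True) malg_der.
Proof.
split=> [a f g _ _|f g _ _]; first exact: malg_der_linear.
have der0 : malg_der 0 = 0 by rewrite /malg_der msupp0 big_seq_fset0.
(* Both sides of the Leibniz rule are bilinear, so two inductions reduce it to monomials. *)
elim/malg_ind: f => [|a m f IH]; first by rewrite der0 !mul0r addr0 der0.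
apply: (leibnizDl malg_der_linear) IH.
elim/malg_ind: g => [|b k g IH]; first by rewrite der0 !mulr0 addr0 der0.
apply: (leibnizDr malg_der_linear) IH.
have := monomial_derM m k.
rewrite -(malg_der_monomial k) -(malg_der_monomial m).
rewrite -(malg_der_monomial (mmul m k)) (monomialM K m k); exact.
Qed.

End DerivationOfVariables.

(** * Degrees modulo [d] and the Veronese grading *)

Section Degree.
Variables (K : fieldType) (n : nat) (mu : nat -> 'I_n -> nat) (d : nat).
Hypothesis d_gt0 : (0 < d)%N.
Implicit Types (f g : poly_alg K) (m : {cmonom nat}).

Lemma monom_degEw (s : {fset nat}) m : (finsupp m `<=` s)%fset ->
  monom_deg mu m = (\sum_(j <- s) m j * basis_deg mu j)%N.
Proof.
move=> le_s; apply: big_fset_incl => // j _.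
by rewrite -cmE_eq0 => /eqP->.
Qed.

Lemma monom_degM m1 m2 :
  monom_deg mu (mmul m1 m2) = (monom_deg mu m1 + monom_deg mu m2)%N.
Proof.
rewrite (@monom_degEw _ m1 (fsubsetUl _ (finsupp m2))).
rewrite (@monom_degEw _ m2 (fsubsetUr (finsupp m1) _)).
rewrite /monom_deg mdomD -big_split; apply: eq_bigr => j _.
by rewrite cmM mulnDl.
Qed.

Lemma monom_deg_var j : monom_deg mu (ucm j) = basis_deg mu j.
Proof. by rewrite /monom_deg mdomU big_seq_fset1 cmUU mul1n. Qed.

Lemma monom_deg1 : monom_deg mu mone = 0%N.
Proof. by rewrite /monom_deg mdom1 big_seq_fset0. Qed.

Lemma monom_deg_pow m p :
  monom_deg mu (cmonom_pow m p) = (p * monom_deg mu m)%N.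
Proof. by elim: p => [|p IH]; rewrite ?monom_deg1 // mulSn -IH -monom_degM. Qed.

(** The component of degree [r] modulo [d], described by supports instead of linear spans; [r] need
    not be reduced, so degrees simply add under products. *)
Definition deg_mod (r : nat) f : Prop :=
  forall m, m \in msupp f -> monom_deg mu m = r %[mod d].

Lemma deg_mod_eq r r' f : r = r' %[mod d] -> deg_mod r f -> deg_mod r' f.
Proof. by move=> E H m /H ->. Qed.

Lemma deg_mod0 r : deg_mod r 0.
Proof. by move=> m; rewrite msupp0 in_fset0. Qed.

Lemma deg_mod_monomial m : deg_mod (monom_deg mu m) << m >>.
Proof. by move=> k; rewrite msuppU1 => /fset1P->. Qed.

Lemma deg_mod_var j : deg_mod (basis_deg mu j) (poly_var K j).
Proof. by rewrite -monom_deg_var; apply: deg_mod_monomial. Qed.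

Lemma deg_modD r f g : deg_mod r f -> deg_mod r g -> deg_mod r (f + g).
Proof.
move=> Hf Hg m /(fsubsetP (msuppD_le _ _)); rewrite in_fsetU.
by case/orP=> [/Hf|/Hg].
Qed.

Lemma deg_modZ r (a : K) f : deg_mod r f -> deg_mod r (a *: f).
Proof. by move=> Hf m /(fsubsetP (msuppZ_le _ _)) /Hf. Qed.

Lemma deg_modMn r p f : deg_mod r f -> deg_mod r (f *+ p).
Proof. by rewrite -[_ *+ p]scaler_nat; apply: deg_modZ. Qed.

Lemma deg_modM r r' f g :
  deg_mod r f -> deg_mod r' g -> deg_mod (r + r') (f * g).
Proof.
move=> Hf Hg m /msuppM_le[m1 [m2 [/Hf H1 /Hg H2 ->]]].
by rewrite monom_degM -modnDm H1 H2 modnDm.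
Qed.

Lemma deg_modX r p f : deg_mod r f -> deg_mod (p * r) (f ^+ p).
Proof.
move=> Hf; elim: p => [|p IH].
  by move=> m; rewrite expr0 -mpolyC1E msuppU1 => /fset1P->; rewrite monom_deg1.
by rewrite exprS mulSn; apply: deg_modM.
Qed.

Lemma deg_mod_sum (T : eqType) r (s : seq T) (F : T -> poly_alg K) :
  (forall i, i \in s -> deg_mod r (F i)) -> deg_mod r (\sum_(i <- s) F i).
Proof.
move=> H; rewrite big_seq; apply: big_ind => [|f g|i /H //].
  exact: deg_mod0.
exact: deg_modD.
Qed.

(** No monomial [m] of [f] is lost in the product, so [(d-1) deg e_j + deg m] is 0 modulo [d], as is
    [d deg e_j]; subtract. *)
Lemma deg_mod_cofactor j f : d%:R != 0 :> K ->
  deg_mod 0 (poly_var K j ^+ d.-1 * f *+ d) -> deg_mod (basis_deg mu j) f.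
Proof.
move=> d0 H m mf.
have /H : mmul (cmonom_pow (ucm j) d.-1) m \in
    msupp (poly_var K j ^+ d.-1 * f *+ d).
  rewrite -[X in msupp X]scaler_nat msuppZ (negPf d0) -mcoeff_neq0.
  by rewrite /poly_var monomialX mcoeff_monomialM mcoeff_neq0.
rewrite monom_degM monom_deg_pow monom_deg_var => E.
apply/eqP; rewrite -(eqn_modDl (d.-1 * basis_deg mu j)) E.
by rewrite -mulSnr prednK // modnMr mod0n.
Qed.

(** For the converse, [f] is the combination of its own monomials, each homogeneous of some degree
    [k * d + r] because [r] is the reduced residue. *)
Lemma veronese_partP r f : (r < d)%N -> veronese_part mu d r f <-> deg_mod r f.
Proof.
move=> r_lt; split=> [[p [c [w [Hw ->]]]]|Hf].
  apply: deg_mod_sum => i _; apply: deg_modZ => m; have [k Hk] := Hw i.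
  by move/Hk->; rewrite modnMDl.
pose s : seq {cmonom nat} := enum_fset (msupp f).
exists (size s), (fun i => f@_(tnth (in_tuple s) i)),
  (fun i => << tnth (in_tuple s) i >>); split=> [i|].
  exists (monom_deg mu (tnth (in_tuple s) i) %/ d)%N => m.
  rewrite msuppU1 => /fset1P->; rewrite [LHS](divn_eq _ d).
  have /Hf -> : tnth (in_tuple s) i \in msupp f by apply: mem_tnth.
  by rewrite modn_small.
rewrite {1}(monalgE f) -[RHS](big_tnth _ _ s xpredT (fun m => f@_m *: << m >>)).
apply: eq_bigr => m _; exact: monomialZ.
Qed.

Lemma subalgebra_veronese : subalgebra (veronese_part (K := K) mu d 0).
Proof.
split=> [|a f g|f g]; rewrite !veronese_partP //.
- rewrite -(expr0 1); apply: (@deg_modX 0 0 1) => m.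
  by rewrite -mpolyC1E msuppU1 => /fset1P->; rewrite monom_deg1.
- by move=> Hf; apply/deg_modD/deg_modZ.
- exact: deg_modM.
Qed.

End Degree.

(** * Elementary properties of Lie brackets *)

Section LieBracket.
Variables (K : fieldType) (L : lmodType K) (br : L -> L -> L).
Hypothesis lie_br : lie_bracket br.

Lemma lie_bracketDl u v w : br (u + v) w = br u w + br v w.
Proof. by case: lie_br => lin _ _ _; rewrite -[u]scale1r lin !scale1r. Qed.

Lemma lie_bracketDr u v w : br u (v + w) = br u v + br u w.
Proof. by case: lie_br => _ lin _ _; rewrite -[v]scale1r lin !scale1r. Qed.

Lemma lie_bracketC u v : br u v = - br v u.
Proof.
have [_ _ alt _] := lie_br; apply/eqP; rewrite -addr_eq0.
have := alt (u + v).
by rewrite lie_bracketDl !lie_bracketDr !alt addr0 add0r => ->.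
Qed.

Lemma lie_bracketZl a u v : br (a *: u) v = a *: br u v.
Proof.
have [lin _ _ _] := lie_br; have br0 : br 0 v = 0.
  by apply: (addIr (br 0 v)); rewrite -lie_bracketDl !add0r.
by have := lin a u 0 v; rewrite br0 !addr0.
Qed.

Lemma lie_bracketZr a u v : br u (a *: v) = a *: br u v.
Proof. by rewrite lie_bracketC lie_bracketZl -scalerN -lie_bracketC. Qed.

End LieBracket.

(** * Degrees in the free Lie algebra *)

Section LieDegree.
Variables (K : fieldType) (n : nat) (L : lmodType K) (br : L -> L -> L).
Variables (x : 'I_n -> L) (e : nat -> L) (mu : nat -> 'I_n -> nat).
Hypothesis K_char0 : [pchar K] =i pred0.
Hypothesis freeL : free_lie_algebra br x.
Hypothesis basis_e : multihomogeneous_basis br x e mu.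

(* The eigenspaces of the endomorphism [x_i |-> 2 x_i] are the homogeneous
   components: in characteristic zero the powers of 2 are distinct. *)
Definition lie_homogeneous (N : nat) (v : L) : Prop :=
  forall phi : {linear L -> L}, lie_morphism br br phi ->
    (forall i, phi (x i) = 2%:R *: x i) -> phi v = 2%:R ^+ N *: v.

Lemma lie_homogeneous_var i : lie_homogeneous 1 (x i).
Proof. by move=> phi _ ->. Qed.

Lemma lie_homogeneous_br p q u v :
  lie_homogeneous p u -> lie_homogeneous q v ->
  lie_homogeneous (p + q) (br u v).
Proof.
move=> Hu Hv phi Mphi Xphi; rewrite Mphi (Hu _ Mphi Xphi) (Hv _ Mphi Xphi).
by rewrite (lie_bracketZl freeL.1) (lie_bracketZr freeL.1) scalerA exprD.
Qed.

Lemma lie_homogeneous_eval w :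
  lie_homogeneous (\sum_(i < n) lie_mdeg w i) (lie_eval br x w).
Proof.
elim: w => [i|u IHu v IHv] /=; last first.
  by rewrite big_split; apply: lie_homogeneous_br.
rewrite (bigD1 i) //= eqxx big1 ?addn0; first exact: lie_homogeneous_var.
by move=> j ji; rewrite eq_sym (negPf ji).
Qed.

(** Ties the degree read off from [mu] to the eigenvalue description, which refers to no basis. *)
Lemma lie_homogeneous_basis j : lie_homogeneous (basis_deg mu j) (e j).
Proof.
have [_ /(_ j)[p [c [w [Hw ->]]]]] := basis_e.
move=> phi Mphi Xphi; rewrite linear_sum scaler_sumr; apply: eq_bigr => i _.
have [u [Eu ->]] := Hw i; rewrite linearZ scalerA mulrC -scalerA.
congr (_ *: _); rewrite (lie_homogeneous_eval _ Mphi Xphi).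
by congr (_ ^+ _ *: _); apply: eq_bigr => k _; rewrite Eu.
Qed.

(** Apply the scaling endomorphism to an expansion of [v]: by linear independence each nonzero
    coordinate forces its eigenvalue to be [2^N]. *)
Lemma lie_homogeneous_coord N v : lie_homogeneous N v ->
  exists (p : nat) (c : 'I_p -> K), v = \sum_(i < p) c i *: e i /\
    forall i, c i != 0 -> basis_deg mu i = N.
Proof.
move=> Hv; have [[spanE freeE] _] := basis_e.
have [_ univ] := freeL.
have [[phi [Mphi Xphi]] _] := univ L br (fun i => 2%:R *: x i) freeL.1.
have [p [c Ev]] := spanE v; exists p, c; split=> // i ci.
(* The coordinates of [phi v - 2^N v], which is zero. *)
pose c' (k : 'I_p) := c k * (2%:R ^+ basis_deg mu k - 2%:R ^+ N).
have /(freeE p c')/(_ i)/eqP : \sum_(k < p) c' k *: e k = 0.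
  have /eqP := Hv _ Mphi Xphi; rewrite -subr_eq0 Ev linear_sum scaler_sumr.
  rewrite -sumrB => /eqP E; rewrite -[RHS]E; apply: eq_bigr => k _.
  rewrite linearZ /= (lie_homogeneous_basis _ Mphi Xphi) !scalerA -scalerBl.
  by congr (_ *: _); rewrite /c' mulrBr [2%:R ^+ N * _]mulrC.
rewrite /c' mulf_eq0 (negPf ci) subr_eq0 -!natrX => /eqP.
have natr_inj (a b : nat) : a%:R = b%:R :> K -> a = b.
  wlog le_ab : a b / (a <= b)%N => [H E|E].
    by have [le_ab|/ltnW le_ba] := leqP a b; [apply: H | apply/esym/H].
  have /eqP : (b - a)%:R = 0 :> K by rewrite natrB // E subrr.
  rewrite ((pcharf0P K).1 K_char0) subn_eq0 => le_ba.
  by apply/eqP; rewrite eqn_leq le_ab.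
by move=> /natr_inj /eqP; rewrite eqn_exp2l // => /eqP.
Qed.

Lemma deg_mod_iota (d N : nat) (iota : {linear L -> poly_alg K}) v :
  (forall j, iota (e j) = poly_var K j) ->
  lie_homogeneous N v -> deg_mod mu d N (iota v).
Proof.
move=> iotaE /lie_homogeneous_coord[p [c [-> Hc]]].
rewrite linear_sum; apply: deg_mod_sum => i _; rewrite linearZ iotaE /=.
have [->|/Hc <-] := eqVneq (c i) 0; last exact/deg_modZ/deg_mod_var.
rewrite scale0r; exact: deg_mod0.
Qed.

(** Generators are combinations of basis vectors of degree 1. Were [e j] the only candidate, two
    generators would be multiples of it, against their linear independence. *)
Lemma exists_basis_deg1 (n_ge2 : (2 <= n)%N) j :
  exists2 k, k != j & basis_deg mu k = 1%N.
Proof.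
pose i0 : 'I_n := Ordinal (ltnW n_ge2); pose i1 : 'I_n := Ordinal n_ge2.
have lin_e i : (exists2 k, k != j & basis_deg mu k = 1%N) \/
    exists c : K, x i = c *: e j.
  have [p [c [Ex Hc]]] := lie_homogeneous_coord (@lie_homogeneous_var i).
  have [k /andP[ck kj]|none] :=
      pickP (fun k : 'I_p => (c k != 0) && (val k != j)).
    by left; exists (val k); rewrite ?Hc.
  (* The coefficient of [e j], or 0 when [j] lies outside the range of the expansion. *)
  right; exists (\sum_(k < p | val k == j) c k).
  rewrite Ex scaler_suml (bigID (fun k : 'I_p => val k == j)) /=.
  rewrite [X in _ + X]big1 ?addr0 => [|k kj].
    by apply: eq_bigr => k /eqP->.
  by have := none k; rewrite kj andbT => /negbFE/eqP->; rewrite scale0r.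
have [//|[c0 E0]] := lin_e i0; have [//|[c1 E1]] := lin_e i1.
(* Morphisms to the one-dimensional abelian Lie algebra serve as coordinate functionals on the
   generators. *)
have abelian : @lie_bracket K K^o (fun _ _ => 0).
  by split=> *; rewrite ?scaler0 ?addr0.
have [_ univ] := freeL.
have [[f [_ fx]] _] := univ K^o _ (fun i => (i == i0)%:R) abelian.
have [[g [_ gx]] _] := univ K^o _ (fun i => (i == i1)%:R) abelian.
have := fx i0; rewrite E0 linearZ eqxx => f0.
have := fx i1; rewrite E1 linearZ /= => /eqP.
(* From [f (x i1) = 0]: either [x i1 = 0], contradicting [g (x i1) = 1], or [f (e j) = 0],
   contradicting [f (x i0) = 1]. *)
rewrite mulf_eq0 => /orP[/eqP c10|/eqP fe].
  have := gx i1; rewrite E1 c10 scale0r linear0 eqxx => /eqP.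
  by rewrite eq_sym oner_eq0.
by move: f0; rewrite /= fe scaler0 => /eqP; rewrite eq_sym oner_eq0.
Qed.

End LieDegree.

(** * Compatibility of a derivation with the bracket *)

Section PoissonDefect.
Variables (K : fieldType) (A : comAlgType K).

Lemma derivation_onS (R R' : A -> Prop) D :
  (forall f, R' f -> R f) -> derivation_on R D -> derivation_on R' D.
Proof.
move=> sub [linD leibD]; split=> [a f g /sub Rf /sub|f g /sub Rf /sub].
  exact: linD.
exact: leibD.
Qed.

Lemma derivation_on_zero (R : A -> Prop) : derivation_on R (fun=> 0).
Proof. by split=> *; rewrite ?scaler0 ?mul0r ?mulr0 addr0. Qed.

(* Compare the two expansions of [D ((y^p z)^d) = D ((y^d)^p z^d)]. *)
Lemma derivation_on_powers (R : A -> Prop) D (y z : A) p d :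
  (0 < d)%N -> subalgebra R -> derivation_on R D ->
  R (y ^+ p * z) -> R (y ^+ d) -> R (z ^+ d) ->
  exists g, (y ^+ p) ^+ d * D (z ^+ d) = z ^+ d.-1 * g.
Proof.
case: d => // d _ subR derD Ryz Ry Rz.
have Rw := subalgebraX subR p Ry.
have := derivation_onX subR derD d.+1 Ryz.
have -> : (y ^+ p * z) ^+ d.+1 = (y ^+ d.+1) ^+ p * z ^+ d.+1.
  by rewrite exprMn -!exprM mulnC.
case: derD => _ ->// => E; exists ((y ^+ p) ^+ d * D (y ^+ p * z) *+ d.+1 -
  D ((y ^+ d.+1) ^+ p) * z).
rewrite -exprM mulnC exprM mulrBr mulrnAr mulrA -[z ^+ d * _]mulrC.
by rewrite -exprMn -E /= mulrCA -exprSr addrC addKr.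
Qed.

Variable br : A -> A -> A.
Hypothesis Pbr : poisson_bracket br.

Lemma derivation_on_brr u : derivation_on (fun=> True) (br u).
Proof.
have [[_ linr _ _] leib] := Pbr; split=> *; first exact: linr.
by rewrite leib addrC.
Qed.

Lemma derivation_on_brl u : derivation_on (fun=> True) (br^~ u).
Proof.
have [[linl _ _ _] leib] := Pbr; split=> [*|f g _ _]; first exact: linl.
rewrite (lie_bracketC Pbr.1 (f * g)) leib.
rewrite (lie_bracketC Pbr.1 f) (lie_bracketC Pbr.1 g).
by rewrite mulNr mulrN addrC opprD.
Qed.

Variables (D : A -> A) (derD : derivation_on (fun=> True) D).

Definition poisson_defect u v := D (br u v) - br (D u) v - br u (D v).

(** Transfers bracket compatibility from a map [D'] that is only known to agree with [D] at the
    three elements involved. *)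
Lemma poisson_defect_eq0 D' u v :
  D (br u v) = D' (br u v) -> D u = D' u -> D v = D' v ->
  D' (br u v) = br (D' u) v + br u (D' v) -> poisson_defect u v = 0.
Proof.
by rewrite /poisson_defect => -> -> -> ->; rewrite addrAC addrK subrr.
Qed.

Lemma poisson_defectC u v : poisson_defect u v = - poisson_defect v u.
Proof.
rewrite /poisson_defect (lie_bracketC Pbr.1 u v) (lie_bracketC Pbr.1 (D u)).
rewrite (lie_bracketC Pbr.1 u (D v)).
have [linD _] := derD.
have -> : D (- br v u) = - D (br v u).
  have := linD (-1) (br v u) 0 I I.
  by rewrite (derivation_on0 (subalgebra_full A) derD) !addr0 !scaleN1r.
by rewrite !opprD !opprK addrAC.
Qed.

(** The defect at [u] is the commutator of the derivations [D] and [br u], minus the derivation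
    [br (D u)]. *)
Lemma derivation_on_defectr u : derivation_on (fun=> True) (poisson_defect u).
Proof.
have [linD leibD] := derD.
have [lb leibb] := derivation_on_brr u.
have [lb' leibb'] := derivation_on_brr (D u).
rewrite /poisson_defect; split=> [a f g _ _|f g _ _].
    rewrite lb // lb' // !linD // lb // !scalerBr.
  ring.
rewrite leibb // leibb' // leibD // (derivation_onD derD) // !leibD //.
rewrite (derivation_onD (derivation_on_brr u)) // !leibb //; ring.
Qed.

Lemma derivation_on_defectl v : derivation_on (fun=> True) (poisson_defect^~ v).
Proof.
have [lin leib] := derivation_on_defectr v; split=> [a f g _ _|f g _ _].
  by rewrite !(poisson_defectC _ v) lin // opprD scalerN.
by rewrite !(poisson_defectC _ v) leib // opprD mulNr mulrN.
Qed.

End PoissonDefect.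

(** * Extension from the Veronese subalgebra, and its uniqueness *)

Theorem lemma2 (K : fieldType) (K_char0 : [pchar K] =i pred0)
    (n d : nat) (n_ge2 : (2 <= n)%N) (d_ge2 : (2 <= d)%N)
    (L : lmodType K) (brL : L -> L -> L) (x : 'I_n -> L)
    (e : nat -> L) (mu : nat -> 'I_n -> nat)
    (iota : {linear L -> poly_alg K})
    (brP : poly_alg K -> poly_alg K -> poly_alg K)
    (freeP : free_poisson_algebra brL x e mu iota brP)
    (D : poly_alg K -> poly_alg K)
    (derD : poisson_derivation_on brP (veronese_part mu d 0) D) :
  exists E : poly_alg K -> poly_alg K,
    [/\ graded_poisson_derivation x mu iota brP d E,
        forall f, veronese_part mu d 0 f -> E f = D f
      & forall E' : poly_alg K -> poly_alg K,
          graded_poisson_derivation x mu iota brP d E' ->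
          (forall f, veronese_part mu d 0 f -> E' f = D f) ->
          E' =1 E].
Proof.
have d_gt0 := ltnW d_ge2.
have d_neq0 : d%:R != 0 :> K by rewrite ((pcharf0P K).1 K_char0) -lt0n.
have [freeL basis_e iotaE Pbr brE] := freeP.
have [DV linD leibD brD] := derD.
pose X := poly_var K; pose V := veronese_part (K := K) mu d 0.
have subV : subalgebra V by apply: subalgebra_veronese.
have derVD : derivation_on V D by [].
have degV f : V f <-> deg_mod mu d 0 f by apply: veronese_partP.
have Vmon f m : V f -> m \in msupp f -> V << m >>.
  move/degV=> Vf /Vf m0; apply/degV; apply: deg_mod_eq m0 _.
  exact: deg_mod_monomial.
have Vpow m : V (<< m >> ^+ d).
  apply/degV; apply: (@deg_mod_eq _ _ _ _ (d * monom_deg mu m)).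
    by rewrite modnMr mod0n.
  exact/deg_modX/deg_mod_monomial.
have VX j : V (X j ^+ d) := Vpow (ucm j).
(* Stated with the boolean equality so that [xchoose] can select the cofactors. *)
have dvdT j : exists g, D (X j ^+ d) == X j ^+ d.-1 * g *+ d.
  have [k kj deg_k] := exists_basis_deg1 K_char0 freeL basis_e n_ge2 j.
  (* As [e k] has degree 1, this exponent gives [e_k^p e_j] the degree [d deg e_j]. *)
  pose p := (d.-1 * basis_deg mu j)%N.
  have Vkj : V (X k ^+ p * X j).
    apply/degV; apply: (@deg_mod_eq _ _ _ _ (p * 1 + basis_deg mu j)).
      by rewrite muln1 -mulSnr prednK // modnMr mod0n.
    apply: deg_modM; last exact: deg_mod_var.
    by rewrite -deg_k; apply/deg_modX/deg_mod_var.
  rewrite eq_sym in kj.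
  have [g] := derivation_on_powers d_gt0 subV derVD Vkj (VX k) (VX j).
  rewrite -exprM => /(dvd_varX_coprime kj)[h Eh].
  (* Division by [d] makes room for the factor [d] in [D(e_j^d) = d e_j^(d-1) T_j]. *)
  exists (d%:R^-1 *: h); apply/eqP.
  by rewrite mulrn_divn.
pose T j := xchoose (dvdT j); pose E := malg_der T.
have derE : derivation_on (fun=> True) E by apply: malg_derP.
have derVE : derivation_on V E by apply: derivation_onS derE.
have EX j : E (X j ^+ d) = D (X j ^+ d).
  rewrite (derivation_onX (subalgebra_full _) derE) // /E malg_der_var.
  by rewrite (eqP (xchooseP (dvdT j))).
have EV f : V f -> E f = D f.
  exact: (derivation_on_eq K_char0 d_gt0 subV Vmon Vpow derVE derVD EX).
have deg_T j : deg_mod mu d (basis_deg mu j) (T j).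
  apply: deg_mod_cofactor => //; rewrite -(eqP (xchooseP (dvdT j))).
  by apply/degV; apply: DV; apply: VX.
(* The bracket is [d^2 e_i^(d-1) e_j^(d-1) {e_i, e_j}], of degree [d (deg e_i + deg e_j)]; hence [E]
   and [D] agree on it. *)
have brX i j : V (brP (X i ^+ d) (X j ^+ d)).
  apply/degV.
  rewrite (derivation_onX (subalgebra_full _) (derivation_on_brl Pbr _)) //.
  rewrite (derivation_onX (subalgebra_full _) (derivation_on_brr Pbr _)) //.
  apply: (@deg_mod_eq _ _ _ _ (d.-1 * basis_deg mu i +
    (d.-1 * basis_deg mu j + (basis_deg mu i + basis_deg mu j)))).
    rewrite addnA addnACA -!mulSnr prednK //.
    by rewrite -mulnDr modnMr mod0n.
  apply/deg_modMn/deg_modM; first exact/deg_modX/deg_mod_var.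
  apply/deg_modMn/deg_modM; first exact/deg_modX/deg_mod_var.
  rewrite brE; apply: (deg_mod_iota K_char0 freeL basis_e) iotaE _.
  exact: (lie_homogeneous_br freeL (lie_homogeneous_basis freeL basis_e i)
    (lie_homogeneous_basis freeL basis_e j)).
have brEP f g : E (brP f g) = brP (E f) g + brP f (E g).
  pose R (h : poly_alg K) := True.
  (* Comparison of [F] with the zero derivation on the whole algebra. *)
  have vanish F : derivation_on R F -> (forall j, F (X j ^+ d) = 0) ->
      forall h, F h = 0.
    move=> derF FX h.
    exact: (derivation_on_eq K_char0 d_gt0 (subalgebra_full _) _ _ derF
      (derivation_on_zero R) FX).
  suff /eqP : poisson_defect brP E f g = 0.
    by rewrite /poisson_defect -addrA -opprD subr_eq0 => /eqP.
  (* One argument at a time: first [g] is replaced by [e_j^d], then [f] by [e_i^d]. *)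
  apply: (vanish _ (derivation_on_defectr Pbr derE f)) => j.
  apply: (vanish _ (derivation_on_defectl Pbr derE _)) => i.
  exact: (poisson_defect_eq0 (EV _ (brX i j)) (EV _ (VX i)) (EV _ (VX j))
    (brD _ _ (VX i) (VX j))).
exists E; split=> //.
  split; first by split=> *;
    [exact: I | exact: derE.1 | exact: derE.2 | exact: brEP].
  move=> i; apply/veronese_partP => //.
  (* A generator need not be a basis vector, but it is a combination of basis vectors [e k] of
     degree 1, for which [T k] has degree 1 modulo [d]. *)
  have [p [c [-> Hc]]] :=
    lie_homogeneous_coord K_char0 freeL basis_e (lie_homogeneous_var i).
  rewrite linear_sum; under eq_bigr do rewrite linearZ iotaE.
  rewrite (derivation_on_sum (subalgebra_full _) derE) //.
  apply: deg_mod_sum => k _; have [->|/Hc <-] := eqVneq (c k) 0.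
    rewrite scale0r; exact: deg_mod0.
  by apply: deg_modZ; rewrite /E malg_der_var.
move=> E' [[_ linE' leibE' _] _] E'V f.
have derE' : derivation_on (fun=> True) E' := conj linE' leibE'.
(* Both extensions equal [D] on the powers [e_j^d], and these values determine a derivation of the
   whole algebra. *)
exact: (derivation_on_eq K_char0 d_gt0 (subalgebra_full _) (fun _ _ _ _ => I)
  (fun=> I) derE' derE (fun j => etrans (E'V _ (VX j)) (esym (EX j)))).
Qed.
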